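(* Let $D$ be an oriented graph with vertex set $V$, $|V|=n$, and consider the following conditions on $D$, each depending on a positive real parameter: P1($\alpha$): $\big|\hom_{IV}(D)-\tfrac18\hom(C_4,D)\big|\le \alpha n^4$. P2($\delta$): $\big|\hom_{II}(D)-\tfrac12\hom(C_4,D)\big|\le \tfrac{\delta}{2} n^4$. P3($\beta$): for every $k\in\mathbb{N}$ and every oriented graph $H$ on $k$ vertices, $\big|\hom(H,D)-2^{-e(H)}\hom(\bar H,D)\big|\le \beta n^k$. P4($\eta$): for every $k\in\mathbb{N}$ and every partially oriented graph $H$ on $k$ vertices, $\big|\hom(H,D)-2^{-\vec e(H)}\hom(\bar H,D)\big|\le \eta n^k$. P5($\delta$): $\sum_{x,x',y,y'\in V} M_{xy}M_{xy'}M_{x'y}M_{x'y'}\le \delta n^4$. P6($\gamma$): $\vec e(A,B)-\vec e(B,A)\le \gamma n^2$ for all $A,B\subseteq V$. P7($\varepsilon$): $\mathrm{bias}_{1-\varepsilon}(D)\le \varepsilon n^2$. P8($\delta$): $\sum_{i=1}^n \lambda_i^4\le \delta n^4$. P9($\zeta$): $|\lambda_1|\le \zeta n$. These conditions are equivalent in the following sense: for any two of them, Pi and Pj, and any positive value $p$ of the parameter of Pj, there is a positive value $q$ of the parameter of Pi such that every oriented graph $D$ (on any number $n$ of vertices) satisfying Pi with parameter $q$ satisfies Pj with parameter $p$. Moreover, when the same parameter appears in both conditions (as $\delta$ does in P2, P5 and P8), the deduction holds with equal parameter values.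
   Context: All graphs are finite and simple (no loops or multiple edges). A partially oriented graph is a graph in which some subset of the edges are oriented (each oriented edge, or arc, $\vec{xy}$ goes from $x$ to $y$); oriented graphs (all edges oriented, at most one orientation per pair) and unoriented graphs are special cases. For a partially oriented graph $H$, $e(H)$ is its number of edges, $\vec e(H)$ its number of oriented edges, and $\bar H$ its underlying unoriented graph. For partially oriented graphs $H,D$, a homomorphism from $H$ to $D$ is a map $f:V(H)\to V(D)$ such that $\vec{f(x)f(y)}$ is an arc of $D$ for every arc $\vec{xy}$ of $H$, and $f(x)f(y)$ is an edge of $\bar D$ for every edge $xy$ of $H$; $\hom(H,D)$ is the number of homomorphisms from $H$ to $D$. $C_4$ is the unoriented cycle on vertices $1,2,3,4$ with edges $12,23,34,41$. Each of the 16 orientations of this cycle is classified as follows: call the edge $\{i,i+1\}$ (indices mod 4) forward if it is oriented from $i$ to $i+1$. Type I: 0 or 4 forward edges (2 orientations); Type II: 1 or 3 forward edges (8 orientations); Type III: exactly 2 forward edges which are consecutive around the cycle (4 orientations); Type IV: exactly 2 forward edges which are non-consecutive, i.e. forward and backward alternate (2 orientations). For $T\in\{I,II,III,IV\}$, $\hom_T(D)$ is the sum of $\hom(H,D)$ over the orientations $H$ of this cycle of type $T$. For $A,B\subseteq V$, $\vec e(A,B)$ is the number of pairs $(x,y)\in A\times B$ with $\vec{xy}$ an arc of $D$. $M$ is the $V\times V$ adjacency matrix of $D$: $M_{xy}=1$ if $\vec{xy}$ is an arc, $M_{xy}=-1$ if $\vec{yx}$ is an arc, and $M_{xy}=0$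 otherwise; $M$ is real antisymmetric, so its eigenvalues are purely imaginary; $\lambda_1,\dots,\lambda_n$ denote them listed in order of decreasing absolute value. For $\nu\in(0,1)$, a pair $(A,B)$ of subsets of $V$ is $\nu$-biased if $\vec e(B,A)\le \nu\,\vec e(A,B)$, and $\mathrm{bias}_\nu(D)$ is the maximum of $\vec e(A,B)$ over all $\nu$-biased pairs $(A,B)$. *)

(* Defs.v *)
From HB Require Import structures.
From mathcomp Require Import all_boot all_order all_algebra.
From mathcomp Require Import complex reals.

Set Implicit Arguments.
Unset Strict Implicit.
Unset Printing Implicit Defensive.

Import Order.TTheory GRing.Theory Num.Theory.

(* [adj] is adjacency in the underlying unoriented graph; [arc x y] says that
   the edge xy is oriented from x to y. *)
Record pograph (T : finType) := POGraph {
  adj : rel T;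
  arc : rel T;
  adj_sym : symmetric adj;
  adj_irr : irreflexive adj;
  arc_adj : forall x y, arc x y -> adj x y;
  arc_asym : forall x y, arc x y -> ~~ arc y x }.

Definition oriented (T : finType) (H : pograph T) : Prop :=
  forall x y, adj H x y -> arc H x y || arc H y x.

Section Underlying.
Variables (T : finType) (H : pograph T).

Lemma underlying_arc_adj (x y : T) : false -> adj H x y.
Proof. by []. Qed.

Lemma underlying_arc_asym (x y : T) : false -> ~~ false.
Proof. by []. Qed.

Definition underlying : pograph T :=
  @POGraph T (adj H) (fun _ _ => false) (@adj_sym T H) (@adj_irr T H)
    underlying_arc_adj underlying_arc_asym.

Definition num_edges : nat :=
  #|[set e : {set T} | [exists x, exists y, adj H x y && (e == [set x; y])]]|.

Definition num_arcs : nat := #|[set p : T * T | arc H p.1 p.2]|.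

Definition arcs_between (A B : {set T}) : nat :=
  #|[set p : T * T | [&& p.1 \in A, p.2 \in B & arc H p.1 p.2]]|.

End Underlying.

Definition is_hom (T V : finType) (H : pograph T) (D : pograph V)
    (f : {ffun T -> V}) : bool :=
  [forall x, forall y, (arc H x y ==> arc D (f x) (f y)) &&
                       (adj H x y ==> adj D (f x) (f y))].

Definition nhom (T V : finType) (H : pograph T) (D : pograph V) : nat :=
  #|[set f : {ffun T -> V} | is_hom H D f]|.

(* The vertices 1, 2, 3, 4 of the cycle are represented by 'I_4, with [ordS]
   the cyclic successor.  An orientation of the cycle is given by s, where
   s i = true means that the edge {i, i + 1} is forward. *)
Section FourCycle.

Definition c4_adj (i j : 'I_4) : bool := (j == ordS i) || (i == ordS j).

Definition c4_arc (s : {ffun 'I_4 -> bool}) (i j : 'I_4) : bool :=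
  ((j == ordS i) && s i) || ((i == ordS j) && ~~ s j).

Lemma c4_adj_sym : symmetric c4_adj.
Proof. by move=> i j; rewrite /c4_adj orbC. Qed.

Lemma c4_adj_irr : irreflexive c4_adj.
Proof. by case=> [[|[|[|[|]]]]]. Qed.

Lemma c4_arc_adj s i j : c4_arc s i j -> c4_adj i j.
Proof. by rewrite /c4_arc /c4_adj => /orP[/andP[-> _]|/andP[-> _]]; rewrite ?orbT. Qed.

Lemma c4_arc_asym s i j : c4_arc s i j -> ~~ c4_arc s j i.
Proof.
rewrite /c4_arc => /orP[/andP[/eqP-> si]|/andP[/eqP-> sj]].
  rewrite eqxx si /= orbF negb_and.
  by rewrite (_ : i == ordS (ordS i) = false) //; case: i {si} => [[|[|[|[|]]]]].
rewrite eqxx (negbTE sj) /= negb_and negbK.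
by rewrite (_ : j == ordS (ordS j) = false) //; case: j {sj} => [[|[|[|[|]]]]].
Qed.

Lemma c4_noarc_adj (i j : 'I_4) : false -> c4_adj i j.
Proof. by []. Qed.

Lemma c4_noarc_asym (i j : 'I_4) : false -> ~~ false.
Proof. by []. Qed.

Definition C4 : pograph 'I_4 :=
  POGraph c4_adj_sym c4_adj_irr c4_noarc_adj c4_noarc_asym.

Definition orC4 (s : {ffun 'I_4 -> bool}) : pograph 'I_4 :=
  POGraph c4_adj_sym c4_adj_irr (@c4_arc_adj s) (@c4_arc_asym s).

Inductive c4_type := TypeI | TypeII | TypeIII | TypeIV.

Definition num_forward (s : {ffun 'I_4 -> bool}) : nat := #|[set i | s i]|.

Definition has_type (t : c4_type) (s : {ffun 'I_4 -> bool}) : bool :=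
  let m := num_forward s in
  let consecutive := [exists i, s i && s (ordS i)] in
  match t with
  | TypeI => (m == 0) || (m == 4)
  | TypeII => (m == 1) || (m == 3)
  | TypeIII => (m == 2) && consecutive
  | TypeIV => (m == 2) && ~~ consecutive
  end.

Definition hom_type (t : c4_type) (V : finType) (D : pograph V) : nat :=
  \sum_(s : {ffun 'I_4 -> bool} | has_type t s) nhom (orC4 s) D.

End FourCycle.

Local Open Scope ring_scope.
Local Open Scope complex_scope.

Section Conditions.
Variables (R : realType) (V : finType) (D : pograph V).

Definition adjM (x y : V) : R :=
  if arc D x y then 1 else if arc D y x then -1 else 0.

Definition adj_matrix : 'M[R]_#|V| :=
  \matrix_(i, j) adjM (enum_val i) (enum_val j).

(* The complex eigenvalues with multiplicity, i.e. the roots of the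
   characteristic polynomial, in order of decreasing absolute value. *)
Definition eigenvalues : seq R[i] :=
  sort (fun z w : R[i] => `|w| <= `|z|)
    (sval (closed_field_poly_normal
      (char_poly (map_mx (fun a : R => a%:C) adj_matrix)))).

Definition biased (nu : R) (A B : {set V}) : bool :=
  (arcs_between D B A)%:R <= nu * (arcs_between D A B)%:R.

Definition bias (nu : R) : nat :=
  \max_(p : {set V} * {set V} | biased nu p.1 p.2) arcs_between D p.1 p.2.

Let n : R := #|V|%:R.

Definition P1 (alpha : R) : Prop :=
  `|(hom_type TypeIV D)%:R - 1 / 8 * (nhom C4 D)%:R| <= alpha * n ^+ 4.

Definition P2 (delta : R) : Prop :=
  `|(hom_type TypeII D)%:R - 1 / 2 * (nhom C4 D)%:R| <= delta / 2 * n ^+ 4.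

Definition P3 (beta : R) : Prop :=
  forall (k : nat) (T : finType) (H : pograph T), #|T| = k -> oriented H ->
  `|(nhom H D)%:R - 2 ^- num_edges H * (nhom (underlying H) D)%:R|
    <= beta * n ^+ k.

Definition P4 (eta : R) : Prop :=
  forall (k : nat) (T : finType) (H : pograph T), #|T| = k ->
  `|(nhom H D)%:R - 2 ^- num_arcs H * (nhom (underlying H) D)%:R|
    <= eta * n ^+ k.

Definition P5 (delta : R) : Prop :=
  \sum_(x : V) \sum_(x' : V) \sum_(y : V) \sum_(y' : V)
    adjM x y * adjM x y' * adjM x' y * adjM x' y' <= delta * n ^+ 4.

Definition P6 (gamma : R) : Prop :=
  forall A B : {set V},
  (arcs_between D A B)%:R - (arcs_between D B A)%:R <= gamma * n ^+ 2.

Definition P7 (epsilon : R) : Prop :=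
  (bias (1 - epsilon))%:R <= epsilon * n ^+ 2.

(* The order of R[i] relates only numbers with the same imaginary part: the
   left-hand sides of the next two conditions are real. *)
Definition P8 (delta : R) : Prop :=
  \sum_(i < #|V|) eigenvalues`_i ^+ 4 <= (delta * n ^+ 4)%:C.

(* For empty V there is no eigenvalue and eigenvalues`_0 is 0. *)
Definition P9 (zeta : R) : Prop :=
  `|eigenvalues`_0| <= (zeta * n)%:C.

End Conditions.

Inductive condition :=
  Cond1 | Cond2 | Cond3 | Cond4 | Cond5 | Cond6 | Cond7 | Cond8 | Cond9.

Inductive parameter := Alpha | Beta | Gamma | Delta | Epsilon | Zeta | Eta.

Definition param (c : condition) : parameter :=
  match c with
  | Cond1 => Alpha | Cond2 => Delta | Cond3 => Beta
  | Cond4 => Eta | Cond5 => Delta | Cond6 => Gamma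
  | Cond7 => Epsilon | Cond8 => Delta | Cond9 => Zeta
  end.

Definition satisfies (R : realType) (c : condition) (p : R) (V : finType)
    (D : pograph V) : Prop :=
  match c with
  | Cond1 => P1 D p | Cond2 => P2 D p | Cond3 => P3 D p
  | Cond4 => P4 D p | Cond5 => P5 D p | Cond6 => P6 D p
  | Cond7 => P7 D p | Cond8 => P8 D p | Cond9 => P9 D p
  end.

(* nu-biased pairs are meant for 0 < nu < 1.  In the equivalence, a value
   chosen for the parameter epsilon of P7 is required to be less than 1; as a
   target, P7 with 1 <= epsilon always holds, since then
   bias <= n ^ 2 <= epsilon * n ^ 2. *)
Definition admissible (R : realType) (c : condition) (p : R) : Prop :=
  0 < p /\ (param c = Epsilon -> p < 1).

(* Main.v *)
(** Let M be the antisymmetric adjacency matrix and A = |M|, so that the arc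
    indicator is (A + M) / 2. Expanding the products over a 4-cycle gives
    hom_II = hom(C4) / 2 - tr(M^4) / 2 and
    hom_IV = hom(C4) / 8 + tr(M^4) / 8 + (a sum of squares),
    while the sum in P5 and the sum of the fourth powers of the eigenvalues
    (M is normal) are both tr(M^4); this settles P1 -> P5 and P2 <-> P5 <-> P8.
    Two applications of Cauchy-Schwarz give P5 -> P6. For P6 -> P4, replace the
    arcs of H by unoriented edges one at a time: each replacement costs at most
    gamma n^k / 2 and halves all later errors, so the total is at most
    gamma n^k whatever the number of arcs. P9 -> P8 uses the bound n^2 on the
    sum of the squares |lambda_i|^2. *)
Require Import Defs.
From HB Require Import structures.
From mathcomp Require Import all_boot all_order all_algebra.
From mathcomp Require Import complex reals.
From mathcomp Require Import spectral ring lra.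

Set Implicit Arguments.
Unset Strict Implicit.
Unset Printing Implicit Defensive.

Import Order.TTheory GRing.Theory Num.Theory.
(* [path] has an [arc] of its own, which would shadow the one on pographs. *)
Import Defs.

Local Open Scope ring_scope.

(** Expanding the nonnegative double sum of [(F i - F j) ^+ 2] gives twice the right side minus the
    left. *)
Lemma sqr_sum_le (R : realFieldType) (I : finType) (F : I -> R) :
  (\sum_i F i) ^+ 2 <= #|I|%:R * \sum_i F i ^+ 2.
Proof.
have: 0 <= \sum_i \sum_j (F i - F j) ^+ 2.
  by do 2!apply: sumr_ge0 => ? _; exact: sqr_ge0.
have -> : \sum_i \sum_j (F i - F j) ^+ 2 =
    (#|I|%:R * \sum_i F i ^+ 2 - (\sum_i F i) ^+ 2) *+ 2.
  transitivity (\sum_i (F i ^+ 2 *+ #|I| - 2 * F i * (\sum_j F j)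
                  + \sum_j F j ^+ 2)).
    apply: eq_bigr => i _; rewrite mulr_sumr -sumr_const -sumrB -big_split /=.
    by apply: eq_bigr => j _; ring.
  rewrite big_split sumrB /= sumr_const -mulr_suml -mulr_sumr sumrMnl.
  by rewrite -[_ *+ #|I|]mulr_natl; ring.
by rewrite pmulrn_lge0 // subr_ge0.
Qed.

(** * Codegrees, cut differences and bias: P5, P6 and P7 *)

Section AdjacencyMatrix.
Variables (R : realType) (V : finType) (D : pograph V).
Local Notation M := (@adjM R V D).
Local Notation n := (#|V|%:R : R).

Lemma adjME x y : M x y = (arc D x y)%:R - (arc D y x)%:R.
Proof.
rewrite /adjM; case: ifP => [/arc_asym/negbTE->|_]; first by rewrite subr0.
by case: ifP => _; rewrite sub0r ?oppr0.
Qed.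

Lemma adjM_anti x y : M x y = - M y x.
Proof. by rewrite !adjME opprB. Qed.

Lemma adjM_sqr_le1 x y : M x y ^+ 2 <= 1.
Proof.
rewrite /adjM; case: ifP => _; first by rewrite expr1n.
by case: ifP => _; rewrite ?sqrrN ?expr1n // expr0n ler01.
Qed.

Definition codegree x x' : R := \sum_y M x y * M x' y.

(** This is tr(M^4), the common currency of P2, P5 and P8: [codegree] is the matrix M M^T = -
    M^2. *)
Definition codegree_sqr : R := \sum_x \sum_x' codegree x x' ^+ 2.

Lemma codegree_sqr_ge0 : 0 <= codegree_sqr.
Proof. by do 2!apply: sumr_ge0 => ? _; exact: sqr_ge0. Qed.

Lemma codegree_sqrE :
  \sum_x \sum_x' \sum_y \sum_y' M x y * M x y' * M x' y * M x' y' =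
  codegree_sqr.
Proof.
apply: eq_bigr => x _; apply: eq_bigr => x' _.
rewrite expr2 mulr_suml; apply: eq_bigr => y _.
by rewrite mulr_sumr; apply: eq_bigr => y' _; ring.
Qed.

Lemma P5E (delta : R) : P5 D delta <-> codegree_sqr <= delta * n ^+ 4.
Proof. by rewrite /P5 codegree_sqrE. Qed.

Lemma arcs_betweenE (A B : {set V}) :
  (arcs_between D A B)%:R =
  \sum_x \sum_y (x \in A)%:R * (y \in B)%:R * (arc D x y)%:R :> R.
Proof.
rewrite /arcs_between pair_big /= -sum1_card natr_sum big_mkcond /=.
apply: eq_bigr => -[x y] _; rewrite inE /= -!natrM.
by case: (x \in A); case: (y \in B); case: (arc D x y).
Qed.

Lemma arcs_between_diff (A B : {set V}) :
  (arcs_between D A B)%:R - (arcs_between D B A)%:R =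
  \sum_x \sum_y (x \in A)%:R * (y \in B)%:R * M x y :> R.
Proof.
rewrite !arcs_betweenE [X in _ - X]exchange_big /= -sumrB.
apply: eq_bigr => x _; rewrite -sumrB; apply: eq_bigr => y _.
by rewrite adjME; ring.
Qed.

Lemma arcs_between_le (A B : {set V}) : (arcs_between D A B)%:R <= n ^+ 2.
Proof. by rewrite /arcs_between -natrX ler_nat -mulnn -card_prod max_card. Qed.

(* Cauchy-Schwarz twice, once to remove B and once to remove A. *)
Lemma arcs_between_diff_le (A B : {set V}) :
  ((arcs_between D A B)%:R - (arcs_between D B A)%:R) ^+ 4 <=
  n ^+ 4 * codegree_sqr.
Proof.
rewrite arcs_between_diff exchange_big /=.
set S := \sum_y _; pose a x : R := (x \in A)%:R.
have bool_sqr_le (b : bool) (x : R) : (b%:R * x) ^+ 2 <= x ^+ 2.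
  by case: b; rewrite ?mul1r // mul0r expr0n sqr_ge0.
pose Q := \sum_x \sum_x' a x * a x' * codegree x x'.
have leSQ : S ^+ 2 <= n * Q.
  apply: le_trans (sqr_sum_le _) _; apply: ler_wpM2l; first exact: ler0n.
  (* As a sum over all [y] of squares, [Q] can only exceed the sum restricted to [y \in B]. *)
  rewrite /Q; have -> : \sum_x \sum_x' a x * a x' * codegree x x' =
      \sum_y (\sum_x a x * M x y) ^+ 2.
    under eq_bigr do under eq_bigr do rewrite mulr_sumr.
    under eq_bigr do rewrite exchange_big.
    rewrite exchange_big; apply: eq_bigr => y _ /=.
    rewrite expr2 mulr_suml; apply: eq_bigr => x _.
    by rewrite mulr_sumr; apply: eq_bigr => x' _; ring.
  apply: ler_sum => y _.
  have -> : \sum_x (x \in A)%:R * (y \in B)%:R * M x y =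
      (y \in B)%:R * \sum_x a x * M x y.
    by rewrite mulr_sumr; apply: eq_bigr => x _; rewrite /a; ring.
  exact: bool_sqr_le.
have leQ : Q ^+ 2 <= n ^+ 2 * codegree_sqr.
  rewrite /Q pair_big /=; apply: le_trans (sqr_sum_le _) _.
  rewrite card_prod natrM -expr2; apply: ler_wpM2l; first exact: sqr_ge0.
  rewrite /codegree_sqr pair_big /=; apply: ler_sum => -[x x'] _ /=.
  by rewrite /a -natrM mulnb; exact: bool_sqr_le.
rewrite (exprM S 2 2) (exprM n 2 2).
apply: le_trans (_ : (n * Q) ^+ 2 <= _).
  by rewrite lerXn2r // ?nnegrE ?sqr_ge0 // (le_trans (sqr_ge0 S)).
by rewrite exprMn expr2 -[X in _ <= X]mulrA ler_wpM2l // ?sqr_ge0 // -expr2.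
Qed.

Lemma P5_P6 (gamma : R) : 0 < gamma -> P5 D (gamma ^+ 4) -> P6 D gamma.
Proof.
(* Fourth powers reflect the order only between nonnegative numbers, so a nonpositive difference is
   treated apart. *)
move=> gt0 /P5E le5 A B; set d := _ - _; have [d0|d0] := leP d 0.
  by apply: le_trans d0 _; rewrite mulr_ge0 ?sqr_ge0 ?ltW.
rewrite -(@ler_pXn2r _ 4) ?nnegrE ?(ltW d0) ?mulr_ge0 ?(ltW gt0) ?sqr_ge0 //.
apply: le_trans (arcs_between_diff_le A B) _.
have -> : (gamma * n ^+ 2) ^+ 4 = n ^+ 4 * (gamma ^+ 4 * n ^+ 4) by ring.
by rewrite ler_wpM2l ?exprn_ge0.
Qed.

(** For a biased pair, epsilon e(A,B) <= e(A,B) - e(B,A) <= epsilon^2 n^2; one factor epsilon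
    cancels. *)
Lemma P6_P7 (epsilon : R) : 0 < epsilon -> P6 D (epsilon ^+ 2) -> P7 D epsilon.
Proof.
move=> gt0 le6; rewrite /P7 /bias; apply: (big_ind (fun m => m%:R <= _)).
- by rewrite mulr_ge0 ?sqr_ge0 ?ltW.
- by move=> p q lep leq; rewrite /maxn; case: ifP.
move=> [A B] /= bAB; rewrite -(ler_pM2l gt0) mulrA -expr2.
apply: le_trans (le6 A B).
by move: bAB; rewrite /biased; lra.
Qed.

(** A biased pair has e(A,B) at most the bias; for any other pair the difference is below epsilon
    e(A,B) <= epsilon n^2. *)
Lemma P7_P6 (epsilon : R) : 0 < epsilon -> P7 D epsilon -> P6 D epsilon.
Proof.
move=> gt0 le7 A B.
have [bAB|] := boolP (biased D (1 - epsilon) A B).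
  apply: le_trans le7; rewrite lerBlDr ler_wpDr ?ler0n //.
  by rewrite ler_nat /bias (leq_bigmax_cond (A, B)).
rewrite /biased -ltNge => ltBA.
have : epsilon * (arcs_between D A B)%:R <= epsilon * n ^+ 2.
  by rewrite ler_pM2l // arcs_between_le.
by move: ltBA; lra.
Qed.

End AdjacencyMatrix.

(** * Homomorphism counts under removal of orientations: P6 to P4 to P3 *)

Section Homomorphisms.
Variables (R : realType) (V : finType) (D : pograph V).
Local Notation M := (@adjM R V D).
Local Notation n := (#|V|%:R : R).
Local Notation adjR x y := ((adj D x y)%:R : R).
Hypothesis orientD : oriented D.

Lemma adj_arc x y : adjR x y = (arc D x y)%:R + (arc D y x)%:R.
Proof.
rewrite -natrD; congr _%:R; case xy: (arc D x y).
  by rewrite (arc_adj xy) (negbTE (arc_asym xy)).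
case yx: (arc D y x); first by rewrite adj_sym (arc_adj yx).
by apply/eqP; rewrite eqb0; apply/negP => /orientD; rewrite xy yx.
Qed.

Lemma arcR x y : (arc D x y)%:R = (adjR x y + M x y) / 2.
Proof. by rewrite adj_arc adjME; field. Qed.

Lemma nhomE (T : finType) (H : pograph T) :
  (nhom H D)%:R = \sum_(f : {ffun T -> V}) (is_hom H D f)%:R :> R.
Proof.
rewrite /nhom -sum1_card natr_sum big_mkcond /=.
by apply: eq_bigr => f _; rewrite inE; case: is_hom.
Qed.

Section RemoveArc.
Variables (T : finType) (H : pograph T) (u v : T).
Hypothesis arc_uv : arc H u v.

Definition unarc_rel x y := arc H x y && ((x, y) != (u, v)).

Lemma unarc_adj x y : unarc_rel x y -> adj H x y.
Proof. by move=> /andP[/arc_adj]. Qed.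

Lemma unarc_asym x y : unarc_rel x y -> ~~ unarc_rel y x.
Proof. by move=> /andP[/arc_asym nyx _]; rewrite negb_and nyx. Qed.

Definition unarc := POGraph (@adj_sym T H) (@adj_irr T H) unarc_adj unarc_asym.

Lemma num_arcs_unarc : num_arcs H = (num_arcs unarc).+1.
Proof.
rewrite /num_arcs (cardsD1 (u, v)) inE /= arc_uv add1n; congr _.+1.
by apply: eq_card => -[x y]; rewrite !inE /= /unarc_rel andbC.
Qed.

Lemma uv_neq : u != v.
Proof. by apply: contraTneq (arc_adj arc_uv) => ->; rewrite adj_irr. Qed.

Definition pair_ok (f : T -> V) p q :=
  (arc H p q ==> arc D (f p) (f q)) && (adj H p q ==> adj D (f p) (f q)).

(** The diagonal pairs at [u] and [v] are included harmlessly: adjacency is irreflexive, so they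
    impose no condition. *)
Definition on_uv p q := ((p == u) || (p == v)) && ((q == u) || (q == v)).

Definition hom_off (f : T -> V) :=
  [forall p, forall q, on_uv p q || pair_ok f p q].

(** Together with [is_hom_unarc], this isolates the only factor in which the counts for [H] and
    [unarc] differ: [arc] against [adj] at the images of [u] and [v]. *)
Lemma is_hom_arc (f : {ffun T -> V}) :
  is_hom H D f = arc D (f u) (f v) && hom_off f.
Proof.
apply/'forall_forallP/andP => [homf|[arcf /'forall_forallP offf] p q].
  have /andP[/implyP/(_ arc_uv) ? _] := homf u v; split=> //.
  by apply/'forall_forallP => p q; apply/orP; right; exact: homf.
have /orP[|//] := offf p q.
move=> /andP[/orP[]/eqP-> /orP[]/eqP->]; rewrite ?adj_irr ?implybT.
- by rewrite andbT; apply/implyP => /arc_adj; rewrite adj_irr.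
- by rewrite arcf (arc_adj arcf) !implybT.
- by rewrite (negbTE (arc_asym arc_uv)) [adj D _ _]adj_sym (arc_adj arcf) implybT.
- by rewrite andbT; apply/implyP => /arc_adj; rewrite adj_irr.
Qed.

Lemma is_hom_unarc (f : {ffun T -> V}) :
  is_hom unarc D f = adj D (f u) (f v) && hom_off f.
Proof.
apply/'forall_forallP/andP => [homf|[adjf /'forall_forallP offf] p q].
  have /andP[_ /implyP/(_ (arc_adj arc_uv)) ?] := homf u v; split=> //.
  apply/'forall_forallP => p q; have [//|noton] /= := boolP (on_uv p q).
  move: (homf p q); rewrite /= /unarc_rel /pair_ok.
  suff -> : (p, q) != (u, v) by rewrite andbT.
  by apply: contraNneq noton => -[-> ->]; rewrite /on_uv !eqxx orbT.
have [|noton] := boolP (on_uv p q).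
  rewrite /= /unarc_rel => /andP[/orP[]/eqP-> /orP[]/eqP->]; rewrite ?adj_irr.
  - by rewrite andbT; apply/implyP => /andP[/arc_adj]; rewrite adj_irr.
  - by rewrite eqxx andbF adjf implybT.
  - by rewrite (negbTE (arc_asym arc_uv)) [adj D _ _]adj_sym adjf implybT.
  - by rewrite andbT; apply/implyP => /andP[/arc_adj]; rewrite adj_irr.
have := offf p q; rewrite (negbTE noton) /= => /andP[/implyP h ->].
by rewrite andbT; apply/implyP => /andP[/h].
Qed.

Definition update (f : {ffun T -> V}) x y : {ffun T -> V} :=
  [ffun p => if p == u then x else if p == v then y else f p].

(* Once the other images are fixed, the conditions off {u, v} split into a
   condition on the image of u and a condition on the image of v. *)
Lemma hom_off_split f : exists A B : {set V}, forall x y,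
  hom_off (update f x y) = (x \in A) && (y \in B).
Proof.
(* The second [x] in [update f x x] is a dummy value at [v], since pairs touching [v] are excused
   here; likewise for [y] at [u] in the second set. *)
exists [set x | [forall p, forall q,
    on_uv p q || ((p == v) || (q == v) || pair_ok (update f x x) p q)]].
exists [set y | [forall p, forall q,
    on_uv p q || ((p == u) || (q == u) || pair_ok (update f y y) p q)]].
have vu : (v == u) = false by rewrite eq_sym (negbTE uv_neq).
move=> x y; rewrite !inE; apply/'forall_forallP/andP => [off|].
  split; apply/'forall_forallP => p q; have := off p q.
    case: (on_uv p q) => //=; case: (eqVneq p v) => //= pv.
    case: (eqVneq q v) => //= qv.
    by rewrite /pair_ok /update !ffunE (negbTE pv) (negbTE qv).
  case: (on_uv p q) => //=; case: (eqVneq p u) => //= pu.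
  case: (eqVneq q u) => //= qu.
  by rewrite /pair_ok /update !ffunE (negbTE pu) (negbTE qu).
move=> [/'forall_forallP offx /'forall_forallP offy] p q.
have := offx p q; have := offy p q; rewrite /on_uv /pair_ok /update !ffunE.
case: (eqVneq p u) => [->|pu]; case: (eqVneq q u) => [->|qu];
  rewrite ?eqxx ?(eq_sym u v) ?vu //=;
  case: (eqVneq p v) => //= pv; case: (eqVneq q v) => //= qv.
Qed.

(* The map (f, x, y) |-> (f[u := x, v := y], f u, f v) is an involution. *)
Lemma sum_update (F : {ffun T -> V} -> R) :
  \sum_f \sum_x \sum_y F (update f x y) = n ^+ 2 * \sum_f F f.
Proof.
pose swap (w : {ffun T -> V} * (V * V)) :=
  (update w.1 w.2.1 w.2.2, (w.1 u, w.1 v)).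
have swapK : involutive swap.
  move=> [f [x y]]; rewrite /swap /= !ffunE eqxx eq_sym (negbTE uv_neq) eqxx.
  congr (_, _); apply/ffunP => p; rewrite !ffunE.
  by case: eqP => [->//|_]; case: eqP => [->|].
under eq_bigr do rewrite pair_big.
rewrite pair_big /= (reindex_inj (inv_inj swapK)) /=.
transitivity (\sum_(w : {ffun T -> V} * (V * V)) F w.1).
  by apply: eq_bigr => w _; have /(congr1 fst) /= -> := swapK w.
rewrite -(pair_big xpredT xpredT (fun f _ => F f)) /= mulr_sumr.
by apply: eq_bigr => f _; rewrite sumr_const card_prod -[LHS]mulr_natl natrM expr2.
Qed.

(** Since arc = (adj + M) / 2, the difference is half the sum of M(f u, f v) over the maps
    satisfying [hom_off]. Letting the images of [u] and [v] vary with the rest fixed turns each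
    inner sum into a cut difference, which P6 bounds. *)
Lemma nhom_unarc_diff (gamma : R) : P6 D gamma ->
  `|(nhom H D)%:R - (nhom unarc D)%:R / 2| <= gamma / 2 * n ^+ #|T|.
Proof.
(* The averaging cancels a factor [n ^+ 2], so empty [V] comes first; there both counts vanish, and
   so does [n ^+ #|T|] because [T] contains [u]. *)
move=> le6; have [n0|n0] := posnP #|V|.
  have noV : V -> False by move=> x; have /card0_eq/(_ x) := n0.
  have nhom0 (G : pograph T) : nhom G D = 0%N.
    by apply: eq_card0 => f; case: (noV (f u)).
  rewrite !nhom0 mul0r subrr normr0.
  rewrite n0 expr0n (_ : (#|T| == 0)%N = false) ?mulr0 //.
  by apply/eqP => T0; have := max_card (pred1 u); rewrite card1 T0.
have n2_gt0 : 0 < n ^+ 2 by rewrite exprn_gt0 ?ltr0n.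
pose F (f : {ffun T -> V}) : R := M (f u) (f v) * (hom_off f)%:R.
have -> : (nhom H D)%:R - (nhom unarc D)%:R / 2 = (\sum_f F f) / 2.
  rewrite !nhomE !mulr_suml -sumrB; apply: eq_bigr => f _.
  by rewrite is_hom_arc is_hom_unarc -!mulnb !natrM arcR /F; field.
rewrite normrM [`|2^-1|]gtr0_norm ?invr_gt0 ?ltr0n // mulrAC ler_pM2r ?invr_gt0 ?ltr0n //.
rewrite -(ler_pM2l n2_gt0) -[X in X * `|_|]gtr0_norm // -normrM -sum_update.
have -> : n ^+ 2 * (gamma * n ^+ #|T|) =
    \sum_(f : {ffun T -> V}) gamma * n ^+ 2.
  by rewrite sumr_const card_ffun -[RHS]mulr_natr natrX; ring.
apply: le_trans (ler_norm_sum _ _ _) _; apply: ler_sum => f _.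
have [A [B offE]] := hom_off_split f.
have -> : \sum_x \sum_y F (update f x y) =
    (arcs_between D A B)%:R - (arcs_between D B A)%:R.
  rewrite arcs_between_diff; apply: eq_bigr => x _; apply: eq_bigr => y _.
  rewrite /F offE !ffunE eqxx eq_sym (negbTE uv_neq) eqxx -mulnb natrM.
  by rewrite mulrC.
(* The lower bound is P6 with [A] and [B] exchanged. *)
rewrite ler_norml le6 andbT; have := le6 B A; lra.
Qed.

End RemoveArc.

(* The errors of successive arc removals decay geometrically, so the total is
   bounded independently of the number of arcs. *)
Lemma P6_P4 (gamma : R) : 0 <= gamma -> P6 D gamma -> P4 D gamma.
Proof.
move=> g0 le6 k T H <-; move: {2}(num_arcs H) (erefl (num_arcs H)) => m.
elim: m H => [|m IHm] H arcsH.
  rewrite arcsH expr0 invr1 mul1r.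
  rewrite (_ : nhom H D = nhom (underlying H) D); last first.
    apply: eq_card => f; rewrite !inE; apply: eq_forallb => x.
    apply: eq_forallb => y; congr (_ && _) => /=; apply/implyP => xy.
    by have := cards0_eq arcsH => /setP/(_ (x, y)); rewrite !inE xy.
  by rewrite subrr normr0 mulr_ge0 ?exprn_ge0.
have /card_gt0P[[u v]] : (0 < num_arcs H)%N by rewrite arcsH.
rewrite inE /= => uv; pose H' := unarc H u v.
have arcsH' : num_arcs H' = m by move: arcsH; rewrite (num_arcs_unarc uv) => -[].
have := IHm H' arcsH'; rewrite arcsH arcsH'.
rewrite (_ : nhom (underlying H') D = nhom (underlying H) D) //.
have := nhom_unarc_diff uv le6; rewrite -/H' exprS invfM.
set h := (nhom H D)%:R; set h' := (nhom H' D)%:R; set w := _ ^- m * _ => le1 le2.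
(* One removal costs gamma / 2 and the inductive error gamma is halved, so the total is again
   gamma. *)
have -> : h - 2^-1 / 2 ^+ m * (nhom (underlying H) D)%:R =
  (h - h' / 2) + (h' - w) / 2 by rewrite /w; ring.
apply: le_trans (ler_normD _ _) _.
rewrite [`|(h' - w) / 2|]normrM [`|2^-1|]gtr0_norm ?invr_gt0 ?ltr0n //; lra.
Qed.

(** Forgetting direction maps arcs onto edges; it is injective because arcs are asymmetric and
    loopless. *)
Lemma num_edges_oriented (T : finType) (H : pograph T) :
  oriented H -> num_edges H = num_arcs H.
Proof.
move=> orH; rewrite /num_edges /num_arcs.
rewrite -(card_in_imset (f := fun p : T * T => [set p.1; p.2])).
  apply: eq_card => e; rewrite inE; apply/existsP/imsetP.
    move=> [x /existsP[y /andP[/orH/orP[xy|yx] /eqP->]]].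
      by exists (x, y); rewrite ?inE.
    by exists (y, x); rewrite ?inE // setUC.
  move=> [[x y]]; rewrite inE /= => xy ->.
  by exists x; apply/existsP; exists y; rewrite (arc_adj xy) /=.
move=> [x y] [z t]; rewrite !inE /= => xy zt E.
have : x \in [set z; t] by rewrite -E !inE eqxx.
have : y \in [set z; t] by rewrite -E !inE eqxx orbT.
rewrite !inE => /orP[]/eqP yE /orP[]/eqP xE; subst x y => //.
- by have := arc_adj xy; rewrite adj_irr.
- by have := arc_asym xy; rewrite zt.
- by have := arc_adj xy; rewrite adj_irr.
Qed.

Lemma P4_P3 (beta : R) : P4 D beta -> P3 D beta.
Proof. by move=> le4 k T H Tk orH; rewrite num_edges_oriented //; exact: le4. Qed.

End Homomorphisms.

(** * Explicit coordinates for the 4-cycle and its orientations *)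

Section OrientedFourCycles.

Definition i0 : 'I_4 := Ordinal (isT : 0 < 4)%N.
Definition i1 : 'I_4 := Ordinal (isT : 1 < 4)%N.
Definition i2 : 'I_4 := Ordinal (isT : 2 < 4)%N.
Definition i3 : 'I_4 := Ordinal (isT : 3 < 4)%N.

Lemma ord4P (P : 'I_4 -> Prop) : P i0 -> P i1 -> P i2 -> P i3 -> forall i, P i.
Proof.
move=> P0 P1 P2 P3 i.
by case: i => -[|[|[|[|//]]]] lti; rewrite ?(bool_irrelevance lti isT).
Qed.

Lemma forall_ord4 (P : pred 'I_4) :
  [forall i, P i] = [&& P i0, P i1, P i2 & P i3].
Proof.
by apply/forallP/and4P => [Pi|[? ? ? ?]]; [split | exact: ord4P].
Qed.

Lemma exists_ord4 (P : pred 'I_4) :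
  [exists i, P i] = [|| P i0, P i1, P i2 | P i3].
Proof. by apply: negb_inj; rewrite negb_exists forall_ord4 !negb_or. Qed.

Lemma ordS4 : (ordS i0 = i1) * (ordS i1 = i2) * (ordS i2 = i3) * (ordS i3 = i0).
Proof. by do !split; apply: val_inj. Qed.

Lemma ordS_ordS_neq (i : 'I_4) : (i == ordS (ordS i)) = false.
Proof. by elim/ord4P: i. Qed.

Definition mk4 (W : finType) (a b c d : W) : {ffun 'I_4 -> W} :=
  [ffun i : 'I_4 => nth a [:: a; b; c; d] i].

Lemma mk4E (W : finType) (a b c d : W) :
  (mk4 a b c d i0 = a) * (mk4 a b c d i1 = b) *
  (mk4 a b c d i2 = c) * (mk4 a b c d i3 = d).
Proof. by rewrite !ffunE. Qed.

Lemma sum_ffun4 (S : nmodType) (W : finType) (P : pred {ffun 'I_4 -> W})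
    (F : {ffun 'I_4 -> W} -> S) :
  \sum_(f | P f) F f = \sum_a \sum_b \sum_c \sum_d
    (if P (mk4 a b c d) then F (mk4 a b c d) else 0).
Proof.
under [RHS]eq_bigr do under eq_bigr do rewrite pair_big.
under [RHS]eq_bigr do rewrite pair_big.
rewrite pair_big big_mkcond /=.
pose h (w : W * (W * (W * W))) := mk4 w.1 w.2.1 w.2.2.1 w.2.2.2.
rewrite (reindex h) //.
exists (fun f : {ffun 'I_4 -> W} => (f i0, (f i1, (f i2, f i3)))).
  by move=> [a [b [c d]]] _; rewrite /h /= !mk4E.
by move=> f _; apply/ffunP; apply: ord4P; rewrite /h !mk4E.
Qed.

Lemma has_type_mk4 (a b c d : bool) :
  let m := (a + b + c + d)%N in
  let consecutive := [|| a && b, b && c, c && d | d && a] in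
  (has_type TypeII (mk4 a b c d) = (m == 1%N) || (m == 3%N)) *
  (has_type TypeIV (mk4 a b c d) = (m == 2%N) && ~~ consecutive).
Proof.
have mE : num_forward (mk4 a b c d) = (a + b + c + d)%N.
  rewrite /num_forward -sum1dep_card big_mkcond !big_ord_recl big_ord0 !ffunE.
  by case: a; case: b; case: c; case: d.
by rewrite /= /has_type mE exists_ord4 !ordS4 !mk4E.
Qed.

Lemma orC4_oriented s : oriented (orC4 s).
Proof.
move=> x y /orP[]/eqP-> /=; rewrite /c4_arc eqxx ordS_ordS_neq /=.
  by case: (s x).
by case: (s y).
Qed.

Lemma num_edges_orC4 s : num_edges (orC4 s) = 4.
Proof.
rewrite (num_edges_oriented (@orC4_oriented s)) /num_arcs -[RHS](card_ord 4).
(* [h i] is the arc carried by the edge {i, i + 1}, so arcs correspond to the four indices. *)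
pose h i := if s i then (i, ordS i) else (ordS i, i).
rewrite -cardsT -(card_imset (f := h)); last first.
  move=> i j; rewrite /h; case: (s i); case: (s j) => // -[] // ij ji.
    by move: (ordS_ordS_neq i); rewrite ji -ij eqxx.
  by move: (ordS_ordS_neq j); rewrite -ji ij eqxx.
apply: eq_card => -[x y]; rewrite inE /= /c4_arc; apply/orP/imsetP.
  by case=> /andP[/eqP-> si]; [exists x | exists y]; rewrite /h ?si ?(negbTE si).
by move=> [i _]; rewrite /h; case: ifP => si [-> ->]; [left | right];
  rewrite eqxx ?si.
Qed.

Variables (V : finType) (D : pograph V).

Definition fits (b : bool) x y := if b then arc D x y else arc D y x.

Lemma is_hom_orC4 s f :
  is_hom (orC4 s) D f = [forall i, fits (s i) (f i) (f (ordS i))].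
Proof.
apply/'forall_forallP/forallP => [homf i|fitf x y] /=.
  rewrite /fits; case: ifP => si.
    by have /andP[/implyP-> //] := homf i (ordS i); rewrite /= /c4_arc eqxx si.
  have /andP[/implyP-> //] := homf (ordS i) i.
  by rewrite /= /c4_arc eqxx si orbT.
apply/andP; split; apply/implyP.
  rewrite /c4_arc => /orP[]/andP[/eqP-> si].
    by have := fitf x; rewrite /fits si.
  by have := fitf y; rewrite /fits (negbTE si).
by case/orP => /eqP->; [have := fitf x | have := fitf y]; rewrite /fits;
  case: ifP => _ /arc_adj; rewrite // adj_sym.
Qed.

Lemma is_hom_C4 f : is_hom C4 D f = [forall i, adj D (f i) (f (ordS i))].
Proof.
apply/'forall_forallP/forallP => [homf i|fitf x y] /=.
  by have /andP[_ /implyP->//] := homf i (ordS i); rewrite /= /c4_adj eqxx.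
by apply/implyP => /orP[]/eqP->; rewrite // adj_sym.
Qed.

End OrientedFourCycles.

(** * Counts of oriented 4-cycles: P1, P2, P3 and P5 *)

Section FourCycleCounts.
Variables (R : realType) (V : finType) (D : pograph V).
Local Notation M := (@adjM R V D).
Local Notation n := (#|V|%:R : R).
Local Notation adjR x y := ((adj D x y)%:R : R).
Hypothesis orientD : oriented D.

Definition sum4 (F : V -> V -> V -> V -> R) : R :=
  \sum_x \sum_y \sum_z \sum_w F x y z w.

Lemma eq_sum4 F G : (forall x y z w, F x y z w = G x y z w) -> sum4 F = sum4 G.
Proof. by move=> FG; do 4![apply: eq_bigr => ? _]; exact: FG. Qed.

Lemma sum4D F G :
  sum4 (fun x y z w => F x y z w + G x y z w) = sum4 F + sum4 G.
Proof.
rewrite /sum4 -big_split; apply: eq_bigr => x _; rewrite -big_split.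
by do 2![apply: eq_bigr => ? _; rewrite -big_split].
Qed.

Lemma sum4Z c F : sum4 (fun x y z w => c * F x y z w) = c * sum4 F.
Proof. by rewrite /sum4; do 4![rewrite mulr_sumr; apply: eq_bigr => ? _]. Qed.

Lemma sum4_rot F : sum4 F = sum4 (fun x y z w => F w x y z).
Proof.
rewrite /sum4 exchange_big; apply: eq_bigr => y _.
by rewrite exchange_big; apply: eq_bigr => z _; rewrite exchange_big.
Qed.

(** Cutting the cycle at the opposite vertices [x] and [z] leaves two independent paths, through [y]
    and through [w]. *)
Lemma sum4_prod (F G : V -> V -> V -> R) :
  sum4 (fun x y z w => F x y z * G z w x) =
  \sum_x \sum_z (\sum_y F x y z) * (\sum_w G z w x).
Proof.
apply: eq_bigr => x _; rewrite exchange_big; apply: eq_bigr => z _.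
by rewrite mulr_suml; apply: eq_bigr => y _; rewrite mulr_sumr.
Qed.

Lemma nhom_C4 : (nhom C4 D)%:R =
  sum4 (fun x y z w => adjR x y * adjR y z * adjR z w * adjR w x).
Proof.
rewrite nhomE sum_ffun4; apply: eq_sum4 => x y z w.
by rewrite is_hom_C4 forall_ord4 !ordS4 !mk4E -!mulnb !natrM !mulrA.
Qed.

(** The indicator [fits] as a polynomial in adjacency and M; a backward edge flips the sign of M. *)
Definition fitsR (b : bool) x y : R := (adjR x y + (-1) ^+ (~~ b) * M x y) / 2.

Lemma nhom_orC4 (a b c d : bool) : (nhom (orC4 (mk4 a b c d)) D)%:R =
  sum4 (fun x y z w => fitsR a x y * fitsR b y z * fitsR c z w * fitsR d w x).
Proof.
have fitsE e x y : (fits D e x y)%:R = fitsR e x y.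
  rewrite /fits /fitsR; case: e => /=; rewrite (arcR _ orientD).
    by rewrite expr0 mul1r.
  by rewrite adj_sym adjM_anti; field.
rewrite nhomE sum_ffun4; apply: eq_sum4 => x y z w.
by rewrite is_hom_orC4 forall_ord4 !ordS4 !mk4E -!mulnb !natrM !fitsE; ring.
Qed.

Local Notation N a b c d := (nhom (orC4 (mk4 a b c d)) D).

Lemma hom_typeII : hom_type TypeII D =
  (N true false false false + N false true false false +
   N false false true false + N false false false true +
   N false true true true + N true false true true +
   N true true false true + N true true true false)%N.
Proof.
rewrite /hom_type sum_ffun4 !big_bool !has_type_mk4 /=.
by rewrite !addr0 !add0r; ring.
Qed.

Lemma hom_typeIV : hom_type TypeIV D =
  (N true false true false + N false true false true)%N.
Proof.
by rewrite /hom_type sum_ffun4 !big_bool !has_type_mk4 /= !addr0 !add0r.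
Qed.

Lemma sum4_adjM : sum4 (fun x y z w => M x y * M y z * M z w * M w x) =
  codegree_sqr R D.
Proof.
pose F x y z := M x y * M z y.
rewrite (eq_sum4 (G := fun x y z w => F x y z * F z w x)); last first.
  by move=> x y z w; rewrite /F (adjM_anti _ _ y z) (adjM_anti _ _ w x); ring.
rewrite sum4_prod; apply: eq_bigr => x _; apply: eq_bigr => z _.
rewrite expr2; congr (_ * _); apply: eq_bigr => y _; exact: mulrC.
Qed.

(** Type II consists of the orientations with an odd number of backward edges. Summed over these,
    the signs of every mixed monomial cancel; the pure adjacency and pure M products keep
    coefficients 8/16 and -8/16. *)
Lemma hom_typeII_codegree :
  (hom_type TypeII D)%:R - 1 / 2 * (nhom C4 D)%:R = - (codegree_sqr R D / 2).
Proof.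
rewrite -sum4_adjM nhom_C4 hom_typeII !natrD !nhom_orC4 -!sum4D.
set A := sum4 _; set B := sum4 _; set C := sum4 _.
suff -> : A = 1 / 2 * B + - (1 / 2) * C by field.
rewrite -!sum4Z -sum4D; apply: eq_sum4 => x y z w.
by rewrite /fitsR /= expr0 expr1; field.
Qed.

Lemma P2E (delta : R) : P2 D delta <-> codegree_sqr R D <= delta * n ^+ 4.
Proof.
rewrite /P2 hom_typeII_codegree normrN ger0_norm; last first.
  by rewrite divr_ge0 ?codegree_sqr_ge0.
by rewrite mulrAC ler_pM2r ?invr_gt0 ?ltr0n.
Qed.

(* The surplus of type IV over codegree_sqr / 8 is a sum of squares, built from
   the commutator [U] and the product [W] of the matrices M and A. *)
Lemma hom_typeIV_codegree : codegree_sqr R D / 8 <=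
  (hom_type TypeIV D)%:R - 1 / 8 * (nhom C4 D)%:R.
Proof.
pose W x y z := M x y * adjR y z.
pose U x y z := W x y z - adjR x y * M y z.
have UJ x y z : U z y x = U x y z.
  rewrite /U /W (adjM_anti _ _ z y) (adjM_anti _ _ y x).
  by rewrite [adj D z y]adj_sym [adj D y x]adj_sym; ring.
(* When [G] is the reversal of [F], both paths between [x] and [z] have the same sum, and each
   product is a square. *)
have squares (F G : V -> V -> V -> R) : (forall x y z, G z y x = F x y z) ->
    0 <= sum4 (fun x y z w => F x y z * G z w x).
  move=> GF; rewrite sum4_prod; do 2!apply: sumr_ge0 => ? _.
  by under [X in _ * X]eq_bigr do rewrite GF; rewrite -expr2 sqr_ge0.
have U_ge0 := squares U U UJ.
have W_ge0 : 0 <= sum4 (fun x y z w => W x y z * W x w z).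
  exact: (squares W (fun x y z => W z y x)).
rewrite -sum4_adjM nhom_C4 hom_typeIV natrD !nhom_orC4 -sum4D.
set A := sum4 _; set B := sum4 _; set C := sum4 _.
set SU := sum4 _ in U_ge0; set SW := sum4 _ in W_ge0.
suff : B = 1 / 8 * C + 1 / 8 * A + 1 / 8 * SU + 1 / 4 * SW by lra.
(* [SU] supplies the products whose two M factors are opposite or meet at [x] or [z]. The two
   rotations of [SW] chosen here have them meet at [y] and at [w], so the identity then holds term
   by term. *)
have -> : 1 / 4 * SW = 1 / 8 * sum4 (fun x y z w => W y z w * W y x w) +
    1 / 8 * sum4 (fun x y z w => W w x y * W w z y).
  rewrite (sum4_rot (fun x y z w => W w x y * W w z y)).
  rewrite (sum4_rot (fun x y z w => W z w x * W z y x)).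
  rewrite (sum4_rot (fun x y z w => W y z w * W y x w)).
  by rewrite -/SW; lra.
rewrite -!sum4Z -!sum4D; apply: eq_sum4 => x y z w.
rewrite /fitsR /= expr0 expr1 /U /W (adjM_anti _ _ y x) (adjM_anti _ _ w z).
by rewrite [adj D x w]adj_sym [adj D z y]adj_sym; field.
Qed.

Lemma P1_P5 (delta : R) : P1 D (delta / 8) -> P5 D delta.
Proof.
move=> le1; apply/P5E.
have := le_trans (ler_norm _) le1; have := hom_typeIV_codegree; lra.
Qed.

(** There are two orientations of type IV, each with error at most alpha / 2 around density 2^-4,
    and 2 / 16 = 1 / 8. *)
Lemma P3_P1 (alpha : R) : P3 D (alpha / 2) -> P1 D alpha.
Proof.
move=> le3; rewrite /P1 hom_typeIV natrD.
have le s : `|(nhom (orC4 s) D)%:R - 2 ^- 4 * (nhom C4 D)%:R| <=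
    alpha / 2 * n ^+ 4.
  by have := le3 4%N _ (orC4 s) (card_ord 4) (@orC4_oriented s);
    rewrite num_edges_orC4.
have := le (mk4 true false true false); have := le (mk4 false true false true).
rewrite !ler_norml => /andP[? ?] /andP[? ?]; apply/andP; split; lra.
Qed.

End FourCycleCounts.

(** * Spectral form of the codegree sum: P8 and P9 *)

Section Spectrum.
Local Open Scope complex_scope.
Local Open Scope sesquilinear_scope.
Variables (R : realType) (V : finType) (D : pograph V).
Local Notation M := (@adjM R V D).
Local Notation n := (#|V|%:R : R).
Local Notation C := R[i].

Let A : 'M[C]_#|V| := map_mx (fun a : R => a%:C) (adj_matrix R D).
Let P := spectralmx A.
Let d := spectral_diag A.

Lemma adj_matrix_trC : A ^t* = - A.
Proof.
apply/matrixP => i j; rewrite !mxE adjM_anti -rmorphN; exact: conjc_real.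
Qed.

(** A skew-Hermitian matrix commutes with its adjoint, hence is normal and unitarily
    diagonalizable. *)
Lemma adj_matrix_spectral : A = invmx P *m diag_mx d *m P.
Proof.
by apply/orthomx_spectralP/normalmxP; rewrite adj_matrix_trC mulmxN mulNmx.
Qed.

Lemma diag_spectral : diag_mx d = P *m A *m P ^t*.
Proof.
have uP : P \is unitarymx := spectral_unitarymx A.
rewrite adj_matrix_spectral -invmx_unitary // !mulmxA mulmxV ?spectral_unit //.
by rewrite mul1mx mulmxK ?spectral_unit.
Qed.

(** Unitary conjugation preserves skew-Hermitian matrices; the diagonal entries are then
    compared. *)
Lemma spectral_diag_imaginary j : (d 0 j)^*%R = - d 0 j.
Proof.
have : (diag_mx d) ^t* = - diag_mx d.
  rewrite diag_spectral !trmx_mul !map_mxM adj_matrix_trC.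
  by rewrite -/(P ^t* ^t*) trmxCK mulNmx mulmxN mulmxA.
by move=> /matrixP/(_ j j); rewrite !mxE eqxx !mulr1n.
Qed.

Lemma char_poly_similar (F : fieldType) m (Q B : 'M[F]_m) : Q \in unitmx ->
  char_poly (invmx Q *m B *m Q) = char_poly B.
Proof.
move=> Qu; rewrite /char_poly.
have -> : char_poly_mx (invmx Q *m B *m Q) =
    map_mx polyC (invmx Q) *m char_poly_mx B *m map_mx polyC Q.
  rewrite /char_poly_mx mulmxBr mulmxBl -!map_mxM; congr (_ - _).
  by rewrite scalar_mxC -mulmxA -map_mxM mulVmx // map_mx1 mulmx1.
by rewrite !det_mulmx mulrAC -det_mulmx -map_mxM mulVmx // map_mx1 det1 mul1r.
Qed.

(** Both lists are the roots, with multiplicity, of one monic polynomial, as similarity preserves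
    [char_poly]. Symmetric sums over [eigenvalues] can thus be computed on [d]. *)
Lemma eigenvalues_perm : perm_eq (eigenvalues R D) [seq d 0 j | j : 'I_#|V|].
Proof.
rewrite /eigenvalues perm_sort; case: closed_field_poly_normal => s /= sE.
apply: prod_XsubC_eq; move: sE.
rewrite (monicP (char_poly_monic _)) scale1r => <-.
rewrite -/A adj_matrix_spectral char_poly_similar ?spectral_unit //.
rewrite char_poly_trig ?diag_mx_is_trig // big_map big_enum /=.
by apply: eq_bigr => j _; rewrite !mxE eqxx.
Qed.

Lemma sum_eigenvalues (F : C -> C) :
  \sum_(z <- eigenvalues R D) F z = \sum_j F (d 0 j).
Proof. by rewrite (perm_big _ eigenvalues_perm) /= big_map big_enum. Qed.

Lemma size_eigenvalues : size (eigenvalues R D) = #|V|.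
Proof. by rewrite (perm_size eigenvalues_perm) size_map -cardE card_ord. Qed.

Lemma sqr_spectral_diag j : d 0 j ^+ 2 = - `|d 0 j| ^+ 2.
Proof. by rewrite normCK spectral_diag_imaginary mulrN opprK. Qed.

Lemma spectral_diag4 j : d 0 j ^+ 4 = `|d 0 j| ^+ 4.
Proof. by rewrite (exprM _ 2 2) sqr_spectral_diag sqrrN -exprM. Qed.

Lemma adj_matrix_sqr i k :
  (A *m A) i k = - (codegree R D (enum_val i) (enum_val k))%:C.
Proof.
rewrite mxE -rmorphN -sumrN rmorph_sum (big_enum_val (A := V)) /=.
apply: eq_bigr => j _; rewrite !mxE -rmorphM; congr _%:C.
by rewrite [adjM _ _ (enum_val k) _]adjM_anti mulrN opprK.
Qed.

Let A2_spectral : A *m A = invmx P *m diag_mx (\row_j d 0 j ^+ 2) *m P.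
Proof.
rewrite {1 2}adj_matrix_spectral !mulmxA mulmxK ?spectral_unit //.
rewrite -[_ *m diag_mx d *m diag_mx d]mulmxA mulmx_diag.
by congr (_ *m diag_mx _ *m _); apply/rowP => j; rewrite !mxE expr2.
Qed.

Lemma sum_norm2_spectral :
  \sum_j `|d 0 j| ^+ 2 = (\sum_x codegree R D x x)%:C.
Proof.
have : \tr (A *m A) = \sum_j d 0 j ^+ 2.
  rewrite A2_spectral mxtrace_mulC mulKVmx ?spectral_unit // mxtrace_diag.
  by apply: eq_bigr => j _; rewrite mxE.
under [RHS]eq_bigr do rewrite sqr_spectral_diag.
rewrite sumrN /mxtrace; under eq_bigr do rewrite adj_matrix_sqr.
rewrite sumrN => /oppr_inj <-.
by rewrite rmorph_sum (big_enum_val (A := V)).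
Qed.

(** Both sides equal tr(A^4), computed from the diagonal form and from the entries of A^2. *)
Lemma sum_norm4_spectral : \sum_j `|d 0 j| ^+ 4 = (codegree_sqr R D)%:C.
Proof.
have : \tr (A *m A *m (A *m A)) = \sum_j d 0 j ^+ 4.
  rewrite {1 2}A2_spectral !mulmxA mulmxK ?spectral_unit //.
  rewrite mxtrace_mulC -!mulmxA mulKVmx ?spectral_unit // mulmx_diag.
  by rewrite mxtrace_diag; apply: eq_bigr => j _; rewrite !mxE -exprD.
under [RHS]eq_bigr do rewrite spectral_diag4; move=> <-.
rewrite rmorph_sum (big_enum_val (A := V)); apply: eq_bigr => i _.
rewrite mxE rmorph_sum (big_enum_val (A := V)); apply: eq_bigr => k _.
rewrite !adj_matrix_sqr mulrNN -rmorphM expr2; congr (_ * _)%:C.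
by apply: eq_bigr => y _; rewrite mulrC.
Qed.

Lemma P8E (delta : R) : P8 D delta <-> codegree_sqr R D <= delta * n ^+ 4.
Proof.
rewrite /P8 -lecR -sum_norm4_spectral.
suff -> : \sum_(i < #|V|) (eigenvalues R D)`_i ^+ 4 = \sum_j `|d 0 j| ^+ 4 by [].
rewrite -[in LHS]size_eigenvalues -(big_mkord xpredT (fun i => _`_i ^+ 4)).
rewrite -(big_nth 0 xpredT (fun z => z ^+ 4)) sum_eigenvalues.
by apply: eq_bigr => j _; exact: spectral_diag4.
Qed.

Lemma norm_eigenvalue_le j : `|d 0 j| <= `|(eigenvalues R D)`_0|.
Proof.
have : d 0 j \in eigenvalues R D.
  by rewrite (perm_mem eigenvalues_perm) map_f ?mem_enum.
have : sorted (fun z w : C => `|w| <= `|z|) (eigenvalues R D).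
  by apply: sort_sorted => z w; rewrite orbC real_leVge ?normr_real.
case: eigenvalues => [//|z s] /= zs; rewrite inE => /orP[/eqP->//|].
have := order_path_min _ zs => /(_ _)/allP h; apply: h.
by move=> x y t le1 le2; exact: le_trans le2 le1.
Qed.

Lemma P8_P9 (zeta : R) : 0 < zeta -> P8 D (zeta ^+ 4) -> P9 D zeta.
Proof.
move=> z0 /P8E; rewrite -lecR -sum_norm4_spectral -exprMn rmorphXn /= => le8.
have zn0 : 0 <= (zeta * n)%:C by rewrite ler0c mulr_ge0 // ltW.
rewrite /P9; have [V0|Vpos] := posnP #|V|.
  by rewrite nth_default ?normr0 // size_eigenvalues V0.
have : (eigenvalues R D)`_0 \in eigenvalues R D.
  by rewrite mem_nth // size_eigenvalues.
rewrite (perm_mem eigenvalues_perm) => /mapP[j _ ->].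
rewrite -(@ler_pXn2r _ 4) ?nnegrE //; apply: le_trans le8.
(* The fourth power of the leading eigenvalue is one term of a nonnegative sum. *)
rewrite (bigD1 j) //= lerDl sumr_ge0 // => i _; exact: exprn_ge0.
Qed.

Lemma P9_P8 (zeta : R) : P9 D zeta -> P8 D (zeta ^+ 2).
Proof.
move=> le9; apply/P8E; rewrite -lecR -sum_norm4_spectral.
have -> : zeta ^+ 2 * n ^+ 4 = (zeta * n) ^+ 2 * (n ^+ 2) by ring.
rewrite rmorphM rmorphXn /=.
(* Two of the four factors are bounded by the largest absolute value; the remaining squares sum to
   the sum of [M x y ^+ 2], at most [n ^+ 2]. *)
apply: le_trans (_ : ((zeta * n)%:C) ^+ 2 * \sum_j `|d 0 j| ^+ 2 <= _).
  rewrite mulr_sumr; apply: ler_sum => j _; rewrite (exprD _ 2 2).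
  rewrite ler_wpM2r ?exprn_ge0 // lerXn2r ?nnegrE //.
    exact: le_trans le9.
  exact: le_trans (norm_eigenvalue_le j) le9.
rewrite ler_wpM2l //.
  by rewrite -rmorphXn ler0c sqr_ge0.
rewrite sum_norm2_spectral lecR.
have -> : n ^+ 2 = \sum_(x : V) \sum_(y : V) 1.
  by rewrite !sumr_const -[RHS]mulr_natr expr2.
apply: ler_sum => x _; apply: ler_sum => y _.
by rewrite -expr2 adjM_sqr_le1.
Qed.

End Spectrum.

(** * Assembling all implications through P6 *)

Lemma P6_mono (R : realType) (V : finType) (D : pograph V) (g h : R) :
  g <= h -> P6 D g -> P6 D h.
Proof.
move=> gh le6 A B; apply: le_trans (le6 A B) _.
by rewrite ler_wpM2r ?sqr_ge0.
Qed.

Section Hub.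
Variables (R : realType) (V : finType) (D : pograph V).
Hypothesis orientD : oriented D.

(** The route is P6, P4, P3, P1, P5; the factor 16 combines 2 from [P3_P1] and 8 from [P1_P5]. *)
Lemma P6_P5 (delta : R) : 0 < delta -> P6 D (delta / 16) -> P5 D delta.
Proof.
move=> d0 le6; apply: (P1_P5 orientD); apply: P3_P1.
have -> : delta / 8 / 2 = delta / 16 by field.
by apply: P4_P3; apply: (P6_P4 orientD); rewrite // divr_ge0 // ltW.
Qed.

Lemma P3_P6 (gamma : R) : 0 < gamma -> P3 D (gamma ^+ 4 / 16) -> P6 D gamma.
Proof.
move=> g0 le3; apply: (P5_P6 g0); apply: (P1_P5 orientD); apply: P3_P1.
by have -> : gamma ^+ 4 / 8 / 2 = gamma ^+ 4 / 16 by field.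
Qed.

End Hub.

Definition forces (R : realType) (i : condition) (q : R) (j : condition)
    (p : R) : Prop :=
  forall (V : finType) (D : pograph V),
    oriented D -> satisfies i q D -> satisfies j p D.

Lemma forces_P6 (R : realType) (i : condition) (p : R) : 0 < p ->
  exists q : R, admissible i q /\ forces i q Cond6 p.
Proof.
move=> p0; have p4 : 0 < p ^+ 4 by rewrite exprn_gt0.
case: i.
- exists (p ^+ 4 / 8); split=> [|V D orD /=]; first by split; rewrite ?divr_gt0.
  by move=> /(P1_P5 orD)/(P5_P6 p0).
- exists (p ^+ 4); split=> // V D orD /= /(P2E orD)/P5E; exact: P5_P6.
- exists (p ^+ 4 / 16); split=> [|V D orD /=]; first by split; rewrite ?divr_gt0.
  exact: (P3_P6 orD p0).
- exists (p ^+ 4 / 16); split=> [|V D orD /=]; first by split; rewrite ?divr_gt0.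
  by move=> /P4_P3; exact: (P3_P6 orD p0).
- exists (p ^+ 4); split=> // V D orD /=; exact: P5_P6.
- by exists p; split; [split | move=> V D _].
(* The cap 1 / 2 keeps epsilon below 1, as admissibility demands; [P6_mono] returns to [p]. *)
- exists (Num.min p (1 / 2)).
  have q0 : 0 < Num.min p (1 / 2) by rewrite lt_min p0 divr_gt0.
  split=> [|V D orD /= /(P7_P6 q0)]; last by apply: P6_mono; rewrite ge_min lexx.
  by split=> // _; rewrite gt_min; apply/orP; right; lra.
- exists (p ^+ 4); split=> // V D orD /= /P8E/P5E; exact: P5_P6.
- exists (p ^+ 2); split=> [|V D orD /=]; first by split; rewrite ?exprn_gt0.
  by move=> /P9_P8; rewrite -exprM => /P8E/P5E; exact: P5_P6.
Qed.

Lemma P6_forces (R : realType) (j : condition) (p : R) : 0 < p ->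
  exists q : R, 0 < q /\ forces Cond6 q j p.
Proof.
move=> p0; have p16 : 0 < p / 16 by rewrite divr_gt0.
case: j.
- exists (p / 2); split=> [|V D orD /= le6]; first by rewrite divr_gt0.
  by apply: P3_P1; apply: P4_P3; apply: (P6_P4 orD); rewrite // divr_ge0 // ltW.
- by exists (p / 16); split=> // V D orD /= /(P6_P5 orD p0)/P5E/(P2E orD).
- by exists p; split=> // V D orD /= /(P6_P4 orD (ltW p0))/P4_P3.
- by exists p; split=> // V D orD /= /(P6_P4 orD (ltW p0)).
- by exists (p / 16); split=> // V D orD /= /(P6_P5 orD p0).
- by exists p; split=> // V D _.
- by exists (p ^+ 2); rewrite exprn_gt0 //; split=> // V D _; exact: P6_P7.
- by exists (p / 16); split=> // V D orD /= /(P6_P5 orD p0)/P5E/P8E.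
- have p4 : 0 < p ^+ 4 by rewrite exprn_gt0.
  exists (p ^+ 4 / 16); split=> [|V D orD /=]; first by rewrite divr_gt0.
  by move=> /(P6_P5 orD p4)/P5E/P8E; exact: P8_P9.
Qed.

Theorem theorem1p1 (R : realType) :
  (forall (i j : condition) (p : R), 0 < p ->
     exists q : R, admissible i q /\
       forall (V : finType) (D : pograph V),
         oriented D -> satisfies i q D -> satisfies j p D)
  /\
  (forall (i j : condition) (p : R), param i = param j -> 0 < p ->
     forall (V : finType) (D : pograph V),
       oriented D -> satisfies i p D -> satisfies j p D).
Proof.
split=> [i j p p0|i j p].
  have [r [r0 r_p]] := P6_forces j p0; have [q [adm q_r]] := forces_P6 i r0.
  by exists q; split=> // V D orD /(q_r _ _ orD)/(r_p _ _ orD).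
(* Distinct conditions share only delta, and P2, P5 and P8 all reduce to the same bound on
   [codegree_sqr]. *)
by case: i; case: j => // _ p0 V D orD /=;
  rewrite ?(P2E orD) ?P5E ?P8E.
Qed.
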